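(* Let $p \geq 5$ be a prime number such that $X^3-X-1$ has three distinct roots $\alpha,\beta,\gamma$ in $\mathbb{F}_p$, and let $N_p=\min\{|\alpha/\beta|,|\beta/\gamma|,|\gamma/\alpha|\}$, where $|x|$ denotes the multiplicative order of $x\in\mathbb{F}_p^*$. Assume $p\le N_p^2+1$. Then a $\Phi_{3}$-sequence $(a_n)_{n\in\mathbb{Z}}$ in $\mathbb{F}_p$ is a complete Padovan sequence if and only if $a_n=b^n$ for all $n$, where $b$ is a Padovan primitive root.
   Context: For a prime $p\ge 5$ and $\kappa\in\{2,\dots,p-2\}$, a sequence $(a_n)_{n\in\mathbb{Z}}$ of elements of $\mathbb{F}_p$ is a $\Phi_\kappa$-sequence if $a_0=1$ and $a_{n+\kappa}=a_n+a_{n+1}$ in $\mathbb{F}_p$ for all $n\in\mathbb{Z}$. It is complete if it is periodic with period $p-1$ and $\{a_1,\dots,a_{p-2}\}=\{2,\dots,p-1\}$. A complete $\Phi_3$-sequence is called a complete Padovan sequence. A Padovan primitive root is a primitive root $b$ mod $p$ (viewed in $\mathbb{F}_p$) satisfying $b^3=b+1$. *)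

(* Defs.v *)
From mathcomp Require Import all_boot all_order all_algebra all_fingroup.

Set Implicit Arguments.
Unset Strict Implicit.
Unset Printing Implicit Defensive.

Import Order.TTheory GRing.Theory Num.Theory.
Local Open Scope ring_scope.

Definition Phi_sequence (p kappa : nat) (a : int -> 'F_p) : Prop :=
  a 0 = 1 /\ forall n : int, a (n + kappa%:Z) = a n + a (n + 1).

Definition complete_Phi_sequence (p kappa : nat) (a : int -> 'F_p) : Prop :=
  [/\ Phi_sequence kappa a,
      forall n : int, a (n + (p - 1)%N%:Z) = a n
    & [set a (i.+1)%:Z | i : 'I_(p - 2)] = [set (i.+2)%:R | i : 'I_(p - 2)]].

Definition complete_Padovan (p : nat) (a : int -> 'F_p) : Prop :=
  complete_Phi_sequence 3 a.

Definition Padovan_primitive_root (p : nat) (b : 'F_p) : Prop :=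
  (p - 1)%N.-primitive_root b /\ b ^+ 3 = b + 1.

(* The order of x in the unit group of 'F_p, with junk value 0 at x = 0. *)
Definition mult_order (p : nat) (x : 'F_p) : nat :=
  if insub x is Some u then #[u : {unit 'F_p}]%g else 0%N.

Definition min_ratio_order (p : nat) (alpha beta gamma : 'F_p) : nat :=
  minn (mult_order (alpha / beta))
       (minn (mult_order (beta / gamma)) (mult_order (gamma / alpha))).

(* Main.v *)
(* Completeness makes n |-> a_n a bijection from [0, p-1) onto the nonzero
   residues, so all power sums of order 0 < k < p-1 of (a_n) vanish.  Write
   a_n = A alpha^n + B beta^n + C gamma^n.  In the power sum of order k only the
   monomials alpha^i beta^j gamma^l equal to 1 survive.  For k = 3 the only one
   is alpha beta gamma, hence 6ABC = 0, say C = 0.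
   If A and B are nonzero, let N be the order of alpha/beta, so p-1 <= N^2.
   Any (u, v) <> (0, 0) with 0 <= u, v < N and alpha^u beta^v = 1 is a
   contradiction: in the power sum of order u + v, the binomial term of index
   (u, v) is the only survivor.  Such a pair exists: pigeonhole on [0, N)^2 gives
   it or a relation alpha^m = beta^n with 0 < m, n < N; take max(m, n) = n
   minimal.  Pigeonhole on [0, (p-1)/n] x [0, n) then gives the pair or another
   relation alpha^u = beta^v, where minimality forces v < n <= u; but p-1 divides
   the determinant un - vm, which lies strictly between 0 and p-1.
   The case p-1 = N^2, where the first pigeonhole fails, follows since
   beta^(-N) is an N-th root of unity, hence a power of alpha/beta. *)
Require Import Defs.
From mathcomp Require Import all_boot all_order all_algebra all_fingroup.
From mathcomp Require Import all_solvable all_field.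
From mathcomp Require Import zify ring.

Set Implicit Arguments.
Unset Strict Implicit.
Unset Printing Implicit Defensive.

Import Order.TTheory GRing.Theory Num.Theory.
Local Open Scope ring_scope.

(** * Power sums over finite fields *)

Lemma expf_card_pred (F : finFieldType) (x : F) : x != 0 -> x ^+ #|F|.-1 = 1.
Proof.
move=> x0; apply: (mulfI x0); rewrite mulr1 -exprS prednK ?expf_card //.
by apply/card_gt0P; exists 0.
Qed.

Lemma card_nonzero (F : finFieldType) : #|[pred z : F | z != 0]| = #|F|.-1.
Proof. by rewrite -(cardC1 (0 : F)); apply: eq_card => z; rewrite !inE. Qed.

Lemma finField_primitive_root (F : finFieldType) :
  exists g : F, #|F|.-1.-primitive_root g.
Proof.
have c1 : (0 < #|F|.-1)%N.
  by rewrite -card_nonzero; apply/card_gt0P; exists 1; rewrite inE oner_neq0.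
have /hasP [g _ prim_g] : has (#|F|.-1).-primitive_root
    (enum [pred z : F | z != 0]).
  apply: has_prim_root => //; last by rewrite -cardE card_nonzero.
    apply/allP => z; rewrite mem_enum inE => z0.
    by apply/unity_rootP; rewrite expf_card_pred.
  exact: enum_uniq.
by exists g.
Qed.

(** Multiplying the index by a generator [g] permutes the nonzero elements and scales the sum by
    [g ^+ e], which differs from 1. *)
Lemma sum_nonzero_expr (F : finFieldType) (e : nat) :
  (0 < e < #|F|.-1)%N -> \sum_(x : F | x != 0) x ^+ e = 0.
Proof.
case/andP=> e0 eq1; have [g prim_g] := finField_primitive_root F.
have g0 : g != 0 by rewrite (prim_root_eq0 prim_g); lia.
have ge : g ^+ e != 1.
  by rewrite -(prim_order_dvd prim_g) gtnNdvd.
set S := \sum_(x | _) _.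
have : g ^+ e * S = S.
  rewrite /S mulr_sumr [RHS](reindex_inj (mulfI g0)) /=.
  by apply: eq_big => [x|x _]; rewrite ?mulf_eq0 ?negb_or ?g0 // exprMn.
move/eqP; rewrite -subr_eq0 -{2}[S]mul1r -mulrBl mulf_eq0 subr_eq0.
by rewrite (negPf ge) => /eqP.
Qed.

Lemma sum_expr_unity (F : fieldType) (n : nat) (x : F) :
  x ^+ n = 1 -> \sum_(i < n) x ^+ i = if x == 1 then n%:R else 0.
Proof.
move=> xn; case: eqP => [->|/eqP x1].
  by under eq_bigr do rewrite expr1n; rewrite sumr_const card_ord.
have := subrX1 x n; rewrite xn subrr => /esym/eqP.
by rewrite mulf_eq0 subr_eq0 (negPf x1) => /eqP.
Qed.

(** * Multiplicative relations with small exponents *)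

(** Pigeonhole: the box has more points than there are nonzero elements. Two colliding points are
    ordered by first coordinate; the order of their second coordinates decides which form the
    relation takes. *)
Lemma exponent_collision (F : finFieldType) (x y : F) (U V : nat) :
    x != 0 -> y != 0 -> (#|F|.-1 < U * V)%N ->
  exists u v : nat, [/\ (u < U)%N, (v < V)%N, (0 < u + v)%N
    & x ^+ u * y ^+ v = 1 \/ x ^+ u = y ^+ v].
Proof.
move=> x0 y0 ltUV.
pose f (ij : 'I_U * 'I_V) := x ^+ ij.1 * y ^+ ij.2.
have /injectivePn [[i j] [[i' j'] ne fe]] : ~~ injectiveb f.
  apply/negP => /injectiveP injf; move: ltUV; rewrite ltnNge => /negP; apply.
  rewrite -{1}[U]card_ord -{1}[V]card_ord -card_prod -card_nonzero.
  rewrite -(card_codom injf); apply: subset_leq_card; apply/subsetP => z.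
  by case/codomP => ij ->; rewrite inE mulf_neq0 ?expf_neq0.
wlog le_i : i i' j j' ne fe / (i <= i')%N => [hw|].
  case: (leqP i i') => [|/ltnW] le; first exact: (hw i i' j j').
  by apply: (hw i' i j' j) => //; rewrite eq_sym.
have ne' : (i < i')%N \/ (j != j' :> nat).
  case: (ltnP i i') => [|le']; [by left | right].
  apply: contra ne => /eqP ej; apply/eqP; congr pair; apply: val_inj => //=.
  by apply/eqP; rewrite eqn_leq le_i le'.
have xi0 : x ^+ i != 0 by rewrite expf_neq0.
have {}fe : y ^+ j = x ^+ (i' - i) * y ^+ j'.
  apply: (mulfI xi0); rewrite mulrA -exprD subnKC //.
have lti := ltn_ord i'; have ltj := ltn_ord j; have ltj' := ltn_ord j'.
case: (leqP j j') => le_j.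
  exists (i' - i)%N, (j' - j)%N; split; try lia; left.
  have yj0 : y ^+ j != 0 by rewrite expf_neq0.
  by apply: (mulIf yj0); rewrite mul1r -mulrA -exprD subnK.
exists (i' - i)%N, (j - j')%N; split; try lia; right.
have yj0 : y ^+ j' != 0 by rewrite expf_neq0.
by apply: (mulIf yj0); rewrite -fe -exprD subnK // ltnW.
Qed.

Lemma expr_sub_eq1 (F : fieldType) (z : F) (a b : nat) :
  z != 0 -> (b <= a)%N -> z ^+ a = z ^+ b -> z ^+ (a - b) = 1.
Proof.
by move=> z0 le e; apply: (mulIf (expf_neq0 b z0)); rewrite -exprD subnK ?mul1r.
Qed.

(** Descent on the larger exponent [n], bounded by [k]. The induction generalizes [x] and [y]
    because a smaller relation may have its larger exponent on [x]; the hypotheses are symmetric in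
    the two. The hypothesis on common periods replaces divisibility of the determinant by [#|F|.-1]
    with a lower bound. *)
Lemma exponent_descent (F : finFieldType) (N m n : nat) (x y : F) :
    x != 0 -> y != 0 -> x ^+ N = y ^+ N ->
    (forall t, (0 < t < N)%N -> x ^+ t != y ^+ t) ->
    (forall t, (0 < t)%N -> x ^+ t = 1 -> y ^+ t = 1 -> (#|F|.-1 <= t)%N) ->
    (0 < m < n)%N -> (n < N)%N -> x ^+ m = y ^+ n ->
  exists u v : nat, [/\ (u < N)%N, (v < N)%N, (0 < u + v)%N
    & x ^+ u * y ^+ v = 1].
Proof.
set q := #|F|.-1.
have [k] : exists k, (n <= k)%N by exists n.
elim: k m n x y => [|k IH] m n x y; first lia.
move=> le_nk x0 y0 eqN neN per /andP[m0 ltmn] ltnN eqmn.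
(* Raising the relation to the power [N] shows that [(n - m) * N] is a common period, so it is at
   least [q]; this keeps the side [q %/ n] of the next box below [N]. *)
have lt_q : (q < n * N)%N.
  have le : (m * N <= n * N)%N by rewrite leq_mul2r (ltnW ltmn) orbT.
  have yp : y ^+ (n * N) = y ^+ (m * N).
    by rewrite exprM -eqmn -exprM mulnC exprM eqN -exprM mulnC.
  have xp : x ^+ (n * N) = x ^+ (m * N).
    by rewrite ![(_ * N)%N]mulnC !exprM eqN -!exprM ![(N * _)%N]mulnC.
  have := per (n * N - m * N)%N; rewrite !expr_sub_eq1 // => /(_ _ erefl erefl).
  by nia.
have n0 : (0 < n)%N by lia.
have lt_U : (q %/ n < N)%N by rewrite ltn_divLR // mulnC.
have lt_box : (q < (q %/ n).+1 * n)%N by rewrite -ltn_divLR.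
have [u [v [ltu ltv uv0 [rel|rel]]]] := exponent_collision x0 y0 lt_box.
  by exists u, v; split=> //; lia.
have [u0|u_gt0] := posnP u.
  by exists u, v; split; [lia | lia | lia | rewrite -rel u0 mulr1].
have [v0|v_gt0] := posnP v.
  by exists u, v; split; [lia | lia | lia | rewrite rel v0 mulr1].
have neuv : u != v.
  apply: contraTneq (neN u _); last by lia.
  by move=> {2}->; rewrite rel eqxx.
(* If [u < n], both exponents are below [n] and the induction hypothesis applies, with [x] and [y]
   swapped when [v < u]. *)
have [lt_un|le_nu] := ltnP u n.
  have [ltuv|leuv] := ltnP u v.
    by apply: (IH u v x y) => //; lia.
  have neN' t : (0 < t < N)%N -> y ^+ t != x ^+ t by move=> /neN; rewrite eq_sym.
  have per' t : (0 < t)%N -> y ^+ t = 1 -> x ^+ t = 1 -> (q <= t)%N.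
    by move=> t0 yt xt; apply: per.
  have [u' [v' [? ? ? ?]]] : exists u' v' : nat, [/\ (u' < N)%N, (v' < N)%N,
      (0 < u' + v')%N & y ^+ u' * x ^+ v' = 1].
    by apply: (IH v u y x) => //; lia.
  by exists v', u'; split=> //; [lia | rewrite mulrC].
have lt_det : (m * v < u * n)%N by nia.
have xp : x ^+ (u * n) = x ^+ (m * v).
  by rewrite exprM rel -exprM mulnC exprM -eqmn -exprM.
have yp : y ^+ (u * n) = y ^+ (m * v).
  by rewrite mulnC exprM -eqmn -exprM mulnC exprM rel -exprM mulnC.
have := per (u * n - m * v)%N.
rewrite !expr_sub_eq1 ?(ltnW lt_det) // subn_gt0 => /(_ lt_det erefl erefl).
(* The common period [u * n - m * v] is less than [q] because [m * v] is positive. *)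
have : (u * n <= q)%N by rewrite -leq_divRL.
by nia.
Qed.

Lemma expr_eq_prim_ratio (F : fieldType) (x y : F) (N t : nat) :
  y != 0 -> N.-primitive_root (x / y) -> (x ^+ t == y ^+ t) = (N %| t)%N.
Proof.
move=> y0 prim; rewrite (prim_order_dvd prim) expr_div_n.
by apply/eqP/eqP => [->|/divr1_eq //]; rewrite divff ?expf_neq0.
Qed.

Lemma exponent_relation (F : finFieldType) (N : nat) (x y : F) :
    x != 0 -> y != 0 -> N.-primitive_root (x / y) ->
    (#|F|.-1 <= N ^ 2)%N -> (1 < #|F|.-1)%N ->
    (forall t, (0 < t)%N -> x ^+ t = 1 -> y ^+ t = 1 -> (#|F|.-1 <= t)%N) ->
  exists u v : nat, [/\ (u < N)%N, (v < N)%N, (0 < u + v)%N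
    & x ^+ u * y ^+ v = 1].
Proof.
move=> x0 y0 prim leN q1 per.
have N0 := prim_order_gt0 prim.
have eqN : x ^+ N = y ^+ N.
  by apply/eqP; rewrite (expr_eq_prim_ratio _ _ prim).
have neN t : (0 < t < N)%N -> x ^+ t != y ^+ t.
  by case/andP=> t0 ltN; rewrite (expr_eq_prim_ratio _ _ prim) ?gtnNdvd.
move: leN; rewrite leq_eqVlt => /predU1P [eq_q|lt_q].
  have [u yN] : {u : 'I_N | (y ^+ N)^-1 = (x / y) ^+ u}.
    apply: (prim_rootP prim).
    by rewrite exprVn -exprM mulnn -eq_q expf_card_pred // invr1.
  have rel : x ^+ u * y ^+ (N - u) = 1.
    have yu0 : y ^+ u != 0 by rewrite expf_neq0.
    have yN0 : y ^+ N != 0 by rewrite expf_neq0.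
    have -> : x ^+ u = y ^+ u * (y ^+ N)^-1.
      by rewrite yN expr_div_n mulrC divfK.
    by rewrite mulrAC -exprD subnKC ?divff // ltnW.
  (* For [u = 0] the exponent [N - u] would leave the range, but then [N] is a common period, hence
     at least [N ^ 2], although [N ^ 2 > 1]. *)
  have [u0|u_gt0] := posnP u.
    move: rel; rewrite u0 subn0 mul1r => yN1.
    by have := per N N0; rewrite eqN yN1 => /(_ erefl erefl); nia.
  by exists u, (N - u)%N; split=> //; have := ltn_ord u; lia.
have lt_box : (#|F|.-1 < N * N)%N by rewrite mulnn.
have [m [n [ltm ltn mn0 [rel|rel]]]] := exponent_collision x0 y0 lt_box.
  by exists m, n.
have [m0|m_gt0] := posnP m.
  by exists m, n; split; rewrite // -rel m0 mulr1.
have [n0|n_gt0] := posnP n.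
  by exists m, n; split; rewrite // rel n0 mulr1.
have [lt_mn|lt_nm|eq_mn] := ltngtP m n.
- by apply: (@exponent_descent _ N m n) => //; rewrite m_gt0.
- have neN' t : (0 < t < N)%N -> y ^+ t != x ^+ t by move=> /neN; rewrite eq_sym.
  have per' t : (0 < t)%N -> y ^+ t = 1 -> x ^+ t = 1 -> (#|F|.-1 <= t)%N.
    by move=> t0 yt xt; apply: per.
  have [u [v [? ? ? ?]]] : exists u v : nat, [/\ (u < N)%N, (v < N)%N,
      (0 < u + v)%N & y ^+ u * x ^+ v = 1].
    by apply: (@exponent_descent _ N n m) => //; rewrite n_gt0.
  by exists v, u; split=> //; [rewrite addnC | rewrite mulrC].
by have := neN m; rewrite m_gt0 ltm {2}eq_mn rel eqxx => /(_ isT).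
Qed.

(** * Power sums of two-term exponential sequences modulo [p] *)

Lemma prime_ndvd_fact (p k : nat) : prime p -> (k < p)%N -> ~~ (p %| k`!)%N.
Proof.
move=> p_pr; elim: k => [|k IH] ltk; first by rewrite fact0 dvdn1 gtn_eqF ?prime_gt1.
by rewrite factS Euclid_dvdM // negb_or IH ?(ltnW ltk) // gtnNdvd.
Qed.

Lemma Fp_bin_neq0 (p k i : nat) :
  prime p -> (k < p)%N -> (i <= k)%N -> 'C(k, i)%:R != 0 :> 'F_p.
Proof.
move=> p_pr ltk lei; rewrite -(dvdn_pcharf (pchar_Fp p_pr)).
apply: contra (prime_ndvd_fact p_pr ltk) => dvd.
by rewrite -(bin_fact lei) dvdn_mulr.
Qed.

Lemma Fp_expf_pred (p : nat) (x : 'F_p) : prime p -> x != 0 -> x ^+ p.-1 = 1.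
Proof. by move=> p_pr x0; have := expf_card_pred x0; rewrite card_Fp. Qed.

Lemma Fp_sum_expr (p : nat) (x : 'F_p) : prime p -> x != 0 ->
  \sum_(i < p.-1) x ^+ i = if x == 1 then -1 else 0.
Proof.
move=> p_pr x0; rewrite sum_expr_unity ?Fp_expf_pred //.
case: eqP => // _; apply/eqP; rewrite -addr_eq0 natr1.
by rewrite prednK ?prime_gt0 // -(dvdn_pcharf (pchar_Fp p_pr)).
Qed.

(* The only surviving term of the binomial expansion of the power sum of order
   u + v is the one at (u, v), because x ^+ i * y ^+ j = 1 with i + j = u + v
   determines i modulo N and both exponents are below N. *)
Lemma binomial_power_sum (p : nat) (A B x y : 'F_p) (N u v : nat) :
    prime p -> x != 0 -> y != 0 ->
    (forall t, (0 < t < N)%N -> x ^+ t != y ^+ t) ->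
    (u < N)%N -> (v < N)%N -> x ^+ u * y ^+ v = 1 ->
  \sum_(n < p.-1) (A * x ^+ n + B * y ^+ n) ^+ (u + v) =
  - (A ^+ u * B ^+ v *+ 'C(u + v, v)).
Proof.
move=> p_pr x0 y0 neN ltu ltv rel.
have expand n : (A * x ^+ n + B * y ^+ n) ^+ (u + v) =
    \sum_(i < (u + v).+1) (A ^+ (u + v - i) * B ^+ i *+ 'C(u + v, i)) *
       (x ^+ (u + v - i) * y ^+ i) ^+ n.
  rewrite exprDn; apply: eq_bigr => i _.
  rewrite mulrnAl; congr (_ *+ _); rewrite !exprMn -!exprM ![(n * _)%N]mulnC.
  by rewrite mulrACA.
under eq_bigr do rewrite expand.
rewrite exchange_big /=.
under eq_bigr => i _ do rewrite -mulr_sumr Fp_sum_expr ?mulf_neq0 ?expf_neq0 //.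
have lt_v : (v < (u + v).+1)%N by lia.
rewrite (bigD1 (Ordinal lt_v)) //= addnK rel eqxx mulrN1 big1 ?addr0 // => i.
rewrite -val_eqE /= => ne; case: eqP => [rel_i|]; last by rewrite mulr0.
have lti := ltn_ord i.
case: (ltngtP i v) ne => // lt_iv _.
  have /negP[] := neN (v - i)%N ltac:(lia); apply/eqP.
  have z0 : x ^+ u * y ^+ i != 0 by rewrite mulf_neq0 ?expf_neq0.
  apply: (mulfI z0); rewrite mulrAC -exprD -mulrA -exprD (subnKC (ltnW lt_iv)).
  by rewrite rel -rel_i; congr (_ ^+ _ * _); lia.
have /negP[] := neN (i - v)%N ltac:(lia); apply/eqP.
have z0 : x ^+ (u + v - i) * y ^+ v != 0 by rewrite mulf_neq0 ?expf_neq0.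
apply: (mulfI z0); rewrite mulrAC -exprD -mulrA -exprD (subnKC (ltnW lt_iv)).
by rewrite rel_i -rel; congr (_ ^+ _ * _); lia.
Qed.

Lemma two_term_power_sum (p : nat) (A B x y : 'F_p) (N : nat) :
    prime p -> (3 < p)%N -> x != 0 -> y != 0 -> A != 0 -> B != 0 ->
    N.-primitive_root (x / y) -> (p <= N ^ 2 + 1)%N ->
    (forall n : nat, A * x ^+ n + B * y ^+ n != 0) ->
    (forall t, (0 < t)%N -> x ^+ t = 1 -> y ^+ t = 1 -> (p.-1 <= t)%N) ->
  exists2 k : nat, (0 < k < p.-1)%N &
    \sum_(n < p.-1) (A * x ^+ n + B * y ^+ n) ^+ k != 0.
Proof.
move=> p_pr p3 x0 y0 A0 B0 prim leN nz per.
have cardF := card_Fp p_pr.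
have xy0 : x / y != 0 by rewrite mulf_neq0 ?invr_eq0.
have N0 := prim_order_gt0 prim.
have N_dvd : (N %| p.-1)%N.
  by rewrite (prim_order_dvd prim) Fp_expf_pred.
(* If x / y were a generator of the unit group, some value would vanish. *)
have N_ne : N != p.-1.
  apply/eqP => eqN.
  have [i xi] : {i : 'I_N | - B / A = (x / y) ^+ i}.
    apply: (prim_rootP prim); rewrite eqN Fp_expf_pred //.
    by rewrite mulf_neq0 ?invr_eq0 ?oppr_eq0.
  have /negP[] := nz i; apply/eqP.
  have yi : y ^+ i != 0 by rewrite expf_neq0.
  have -> : x ^+ i = - B / A * y ^+ i by rewrite xi expr_div_n divfK.
  by rewrite mulrA mulrCA divff // mulr1 mulNr addNr.
(* [N] is a proper divisor of [p.-1]. Hence [u + v < p.-1], so the order is admissible and the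
   binomial coefficient is nonzero modulo [p]. *)
have leN2 : (2 * N <= p.-1)%N.
  case/dvdnP: N_dvd => [[|[|c]]] e; [lia | | rewrite e; nia].
  by rewrite e mul1n eqxx in N_ne.
have rel_ex := exponent_relation x0 y0 prim; rewrite cardF in rel_ex.
have [u [v [ltu ltv uv0 rel]]] := rel_ex ltac:(lia) ltac:(lia) per.
exists (u + v)%N; first by lia.
rewrite (@binomial_power_sum _ _ _ _ _ N) //.
  rewrite oppr_eq0 -mulr_natr !mulf_neq0 ?expf_neq0 // Fp_bin_neq0 //; lia.
by move=> t /andP[t0 ltN]; rewrite (expr_eq_prim_ratio _ _ prim) ?gtnNdvd.
Qed.

(** * Orders of units, and values of complete sequences *)

Lemma mult_order_primitive (p : nat) (x : 'F_p) :
  x != 0 -> (mult_order x).-primitive_root x.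
Proof.
move=> x0; rewrite /mult_order; case: insubP => [u _ ux|]; last by rewrite unitfE x0.
have [m prim_m m_dvd] : {m | m.-primitive_root x & (m %| #[u]%g)%N}.
  apply: prim_order_exists; first exact: order_gt0.
  by rewrite -ux -FinRing.val_unitX expg_order.
suff -> : #[u]%g = m by [].
apply/eqP; rewrite eqn_dvd m_dvd andbT order_dvdn -val_eqE /= FinRing.val_unitX.
by rewrite [val u]ux (prim_expr_order prim_m).
Qed.

Lemma Fp_natr_ge2_set (p : nat) : prime p ->
  [set (i.+2)%:R | i : 'I_(p - 2)] = [set x : 'F_p | (x != 0) && (x != 1)].
Proof.
move=> p_pr; have p1 := prime_gt1 p_pr.
apply/setP => x; rewrite inE; apply/imsetP/andP => [[i _ ->]|[x0 x1]].
  have lti := ltn_ord i.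
  rewrite -(dvdn_pcharf (pchar_Fp p_pr)) gtnNdvd //; last by lia.
  rewrite -natr1 -subr_eq0 addrK -(dvdn_pcharf (pchar_Fp p_pr)) gtnNdvd //; lia.
have ltx : (x < p)%N by rewrite -[X in (_ < X)%N](Fp_cast p_pr) ltn_ord.
case ex : (nat_of_ord x) ltx => [|[|k]] ltx.
- by rewrite -val_eqE /= ex in x0.
- by rewrite -val_eqE /= ex in x1.
have ltk : (k < p - 2)%N by lia.
by exists (Ordinal ltk) => //=; rewrite -ex natr_Zp.
Qed.

Lemma complete_ne01 (p : nat) (a : int -> 'F_p) (k : nat) :
    prime p -> (5 <= p)%N -> complete_Padovan a ->
  (0 < k < p.-1)%N -> (a k != 0) && (a k != 1).
Proof.
move=> p_pr p5 complete_a; case: complete_a => _ _ im /andP[k0 ltk].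
have ltk' : (k.-1 < p - 2)%N by lia.
have : a k \in [set a (i.+1)%:Z | i : 'I_(p - 2)].
  by apply/imsetP; exists (Ordinal ltk') => //=; rewrite prednK.
by rewrite im Fp_natr_ge2_set // inE.
Qed.

Lemma complete_neq0 (p : nat) (a : int -> 'F_p) (k : nat) :
  prime p -> (5 <= p)%N -> complete_Padovan a -> a k != 0.
Proof.
move=> p_pr p5 complete_a; case: (complete_a) => [[a0 _] per _].
elim/ltn_ind: k => k IH; have [ltk|lek] := ltnP k p.-1; last first.
  have -> : k%:Z = (k - p.-1)%N%:Z + (p - 1)%N%:Z by lia.
  by rewrite per IH; lia.
case: k ltk {IH} => [|k] ltk; first by rewrite a0 oner_neq0.
by case/andP: (@complete_ne01 _ _ k.+1 p_pr p5 complete_a ltk).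
Qed.

Lemma complete_image (p : nat) (a : int -> 'F_p) :
    prime p -> (5 <= p)%N -> complete_Padovan a ->
  [set a i%:Z | i : 'I_p.-1] = [set x | x != 0].
Proof.
move=> p_pr p5 complete_a.
have [[a0 _] _ im] := complete_a.
apply/setP => x; rewrite inE; apply/imsetP/idP => [[i _ ->]|x0].
  exact: complete_neq0.
have [->|x1] := eqVneq x 1.
  have lt0 : (0 < p.-1)%N by lia.
  by exists (Ordinal lt0).
have : x \in [set a (i.+1)%:Z | i : 'I_(p - 2)].
  by rewrite im Fp_natr_ge2_set // inE x0.
case/imsetP => i _ ->; have lti : (i.+1 < p.-1)%N by have := ltn_ord i; lia.
by exists (Ordinal lti).
Qed.

Lemma complete_power_sum (p : nat) (a : int -> 'F_p) (k : nat) :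
    prime p -> (5 <= p)%N -> complete_Padovan a ->
  (0 < k < p.-1)%N -> \sum_(i < p.-1) a i ^+ k = 0.
Proof.
move=> p_pr p5 complete_a ltk.
(* The image is the set of all [p.-1] nonzero residues, so the map from [p.-1] indices is injective
   and the sum can be reindexed. *)
have card : #|[set a i%:Z | i : 'I_p.-1]| == #|'I_p.-1|.
  have := card_nonzero 'F_p; rewrite card_Fp // card_ord complete_image // => <-.
  by apply/eqP/eq_card => x; rewrite !inE.
have /imset_injP inj := card.
transitivity (\sum_(x in [set a i%:Z | i : 'I_p.-1]) x ^+ k).
  by rewrite big_imset.
rewrite complete_image // -[RHS](@sum_nonzero_expr 'F_p k) ?card_Fp //.
by apply: eq_bigl => x; rewrite inE.
Qed.

(** * Closed form through the roots of the cubic *)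

Lemma Phi3_ext (p : nat) (a c : int -> 'F_p) :
  Phi_sequence 3 a -> Phi_sequence 3 c -> a 1 = c 1 -> a 2 = c 2 -> a =1 c.
Proof.
move=> [a0 recA] [c0 recC] e1 e2 n.
suff [] : [/\ a n = c n, a (n + 1) = c (n + 1) & a (n + 2) = c (n + 2)] by [].
elim/int_ind: n => [|n [h0 h1 h2]|n [h0 h1 h2]].
- by rewrite a0 c0 !add0r.
- have -> : n.+1%:Z + 1 = n%:Z + 2 by lia.
  have -> : n.+1%:Z + 2 = n%:Z + 3 by lia.
  have -> : n.+1%:Z = n%:Z + 1 by lia.
  by split; rewrite // recA recC h0 h1.
(* Backward step: the recurrence determines the value at [m] from those at [m + 1] and [m + 3]. *)
set m := - n.+1%:Z.
have em : - n%:Z = m + 1 by rewrite /m; lia.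
rewrite em in h0 h1 h2.
have e12 : m + 1 + 1 = m + 2 by lia.
have e13 : m + 1 + 2 = m + 3 by lia.
rewrite e12 in h1; rewrite e13 in h2.
split=> //; apply: (addIr (a (m + 1))).
by rewrite -recA h0 -recC.
Qed.

Lemma three_point_interpolation (F : fieldType) (x y z a1 a2 : F) :
    uniq [:: x; y; z] ->
  exists A B C : F, [/\ A + B + C = 1, A * x + B * y + C * z = a1
    & A * x ^+ 2 + B * y ^+ 2 + C * z ^+ 2 = a2].
Proof.
rewrite /= !inE negb_or andbT => /andP[/andP[xy xz] yz].
(* This is the Lagrange basis polynomial [(X - v)(X - w) / ((u - v)(u - w))] under the linear map
   sending 1, [X], [X^2] to 1, [a1], [a2]. *)
pose L u v w := (a2 - (v + w) * a1 + v * w) / ((u - v) * (u - w)).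
exists (L x y z), (L y x z), (L z x y).
by split; rewrite /L; field; rewrite !subr_eq0 ?[y == x]eq_sym ?[z == x]eq_sym
  ?[z == y]eq_sym ?xy ?xz ?yz.
Qed.

Lemma root_recurrence_add (F : fieldType) (x : F) (n : int) :
  x != 0 -> x ^+ 3 = x + 1 -> x ^ (n + 3%:Z) = x ^ n + x ^ (n + 1).
Proof.
by move=> x0 x3; rewrite !expfzDr // -!exprnP x3 expr1 mulrDr mulr1 addrC.
Qed.

Lemma Padovan_closed_form (p : nat) (x y z : 'F_p) (a : int -> 'F_p) :
    x != 0 -> y != 0 -> z != 0 -> uniq [:: x; y; z] ->
    x ^+ 3 = x + 1 -> y ^+ 3 = y + 1 -> z ^+ 3 = z + 1 ->
    Phi_sequence 3 a ->
  exists A B C : 'F_p, A + B + C = 1 /\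
    forall n : int, a n = A * x ^ n + B * y ^ n + C * z ^ n.
Proof.
move=> x0 y0 z0 dist x3 y3 z3 Phi_a.
have [A [B [C [sum1 e1 e2]]]] := three_point_interpolation (a 1) (a 2) dist.
exists A, B, C; split=> //.
apply: (@Phi3_ext _ a (fun n => A * x ^ n + B * y ^ n + C * z ^ n)) => //.
split=> [|n]; first by rewrite !expr0z !mulr1.
rewrite !root_recurrence_add // !mulrDr [RHS]addrACA; congr (_ + _).
exact: addrACA.
Qed.

(** Vieta by elimination: subtracting two cubic equations and dividing by the difference of the
    roots gives a quadratic relation; subtracting two of these gives [x + y + z = 0], and
    substituting for [z] gives the product. *)
Lemma Padovan_root_prod (F : fieldType) (x y z : F) :
    uniq [:: x; y; z] -> x ^+ 3 = x + 1 -> y ^+ 3 = y + 1 -> z ^+ 3 = z + 1 ->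
  x * y * z = 1.
Proof.
rewrite /= !inE negb_or andbT => /andP[/andP[xy xz] yz] x3 y3 z3.
have quad (u v : F) : u != v -> u ^+ 3 = u + 1 -> v ^+ 3 = v + 1 ->
    u ^+ 2 + u * v + v ^+ 2 = 1.
  move=> uv u3 v3; apply/eqP; rewrite -subr_eq0; apply/eqP.
  have uv0 : u - v != 0 by rewrite subr_eq0.
  apply: (mulfI uv0); rewrite mulr0.
  have -> : (u - v) * (u ^+ 2 + u * v + v ^+ 2 - 1) = u ^+ 3 - v ^+ 3 - (u - v).
    by ring.
  by rewrite u3 v3; ring.
have qxy := quad _ _ xy x3 y3; have qxz := quad _ _ xz x3 z3.
have yz0 : y - z != 0 by rewrite subr_eq0.
have sum0 : x + y + z = 0.
  apply: (mulfI yz0); rewrite mulr0.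
  have -> : (y - z) * (x + y + z) =
      (x ^+ 2 + x * y + y ^+ 2) - (x ^+ 2 + x * z + z ^+ 2) by ring.
  by rewrite qxy qxz subrr.
have -> : z = - (x + y) by apply/eqP; rewrite -addr_eq0 addrC sum0.
have -> : x * y * - (x + y) = x ^+ 3 - x * (x ^+ 2 + x * y + y ^+ 2) by ring.
by rewrite qxy x3; ring.
Qed.

(** * The power sum of order three *)

(** Each monomial is collected as an [n]-th power, so that summing over [n] yields geometric
    sums. *)
Lemma trinomial_cube_expn (F : fieldType) (A B C x y z : F) (n : nat) :
  (A * x ^+ n + B * y ^+ n + C * z ^+ n) ^+ 3 =
  A ^+ 3 * (x ^+ 3) ^+ n + B ^+ 3 * (y ^+ 3) ^+ n + C ^+ 3 * (z ^+ 3) ^+ n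
  + 3 * A ^+ 2 * B * (x ^+ 2 * y) ^+ n + 3 * A ^+ 2 * C * (x ^+ 2 * z) ^+ n
  + 3 * B ^+ 2 * A * (y ^+ 2 * x) ^+ n + 3 * B ^+ 2 * C * (y ^+ 2 * z) ^+ n
  + 3 * C ^+ 2 * A * (z ^+ 2 * x) ^+ n + 3 * C ^+ 2 * B * (z ^+ 2 * y) ^+ n
  + 6 * A * B * C * (x * y * z) ^+ n.
Proof. by rewrite !(exprAC _ 3 n) !exprMn; ring. Qed.

(* Among the cubic monomials in the three roots only x * y * z equals 1. *)
Lemma Padovan_cubic_power_sum (p : nat) (A B C x y z : 'F_p) :
    prime p -> uniq [:: x; y; z] ->
    x ^+ 3 = x + 1 -> y ^+ 3 = y + 1 -> z ^+ 3 = z + 1 ->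
  \sum_(n < p.-1) (A * x ^+ n + B * y ^+ n + C * z ^+ n) ^+ 3 =
  - (6 * A * B * C).
Proof.
move=> p_pr dist x3 y3 z3.
have xyz := Padovan_root_prod dist x3 y3 z3.
have /and3P[x0 y0 z0] : [&& x != 0, y != 0 & z != 0].
  by rewrite -!negb_or -!mulf_eq0 mulrA xyz oner_neq0.
move: dist; rewrite /= !inE negb_or andbT => /andP[/andP[xy xz] yz].
(* With [u ^+ 3 = u + 1], the value [u ^+ 3 = 1] would force [u = 0]. *)
have cube_sum (u : 'F_p) : u != 0 -> u ^+ 3 = u + 1 -> \sum_(n < p.-1) (u ^+ 3) ^+ n = 0.
  move=> u0 u3; rewrite Fp_sum_expr ?expf_neq0 // u3.
  by rewrite -subr_eq0 addrK (negPf u0).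
(* Here [u ^+ 2 * v = 1 = u * v * w] would force [u = w]. *)
have sq_sum (u v w : 'F_p) : u * v * w = 1 -> u != w ->
    \sum_(n < p.-1) (u ^+ 2 * v) ^+ n = 0.
  move=> uvw uw.
  have /and3P[u0 v0 w0] : [&& u != 0, v != 0 & w != 0].
    by rewrite -!negb_or -!mulf_eq0 mulrA uvw oner_neq0.
  rewrite Fp_sum_expr ?mulf_neq0 ?expf_neq0 //.
  case: eqP => // rel; case/eqP: uw; have uv0 : u * v != 0 by rewrite mulf_neq0.
  by apply: (mulfI uv0); rewrite uvw -rel expr2 -mulrA mulrC.
have prod_sum : \sum_(n < p.-1) (x * y * z) ^+ n = -1.
  by rewrite Fp_sum_expr // xyz ?oner_neq0 ?eqxx.
transitivity (\sum_(n < p.-1)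
   (A ^+ 3 * (x ^+ 3) ^+ n + B ^+ 3 * (y ^+ 3) ^+ n + C ^+ 3 * (z ^+ 3) ^+ n
    + 3 * A ^+ 2 * B * (x ^+ 2 * y) ^+ n + 3 * A ^+ 2 * C * (x ^+ 2 * z) ^+ n
    + 3 * B ^+ 2 * A * (y ^+ 2 * x) ^+ n + 3 * B ^+ 2 * C * (y ^+ 2 * z) ^+ n
    + 3 * C ^+ 2 * A * (z ^+ 2 * x) ^+ n + 3 * C ^+ 2 * B * (z ^+ 2 * y) ^+ n
    + 6 * A * B * C * (x * y * z) ^+ n)).
  by apply: eq_bigr => n _; apply: trinomial_cube_expn.
rewrite !big_split -!mulr_sumr /= !cube_sum // prod_sum.
rewrite (sq_sum x y z) // (sq_sum x z y) 1?mulrAC // (sq_sum y x z) 1?[y * x]mulrC //.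
rewrite (sq_sum y z x) 1?eq_sym //; last by rewrite mulrC mulrA.
rewrite (sq_sum z x y) 1?eq_sym //; last by rewrite -mulrA mulrC.
rewrite (sq_sum z y x) 1?eq_sym //; last by rewrite mulrC [z * y]mulrC mulrA.
by rewrite !(mulr0, mul0r, addr0, add0r) mulrN1.
Qed.

(** * Complete sequences and primitive roots *)

(** [N] is only a lower bound for the order, so the minimum over the three ratios serves every pair
    of roots. *)
Lemma complete_two_term (p : nat) (A B x y : 'F_p) (N : nat) (a : int -> 'F_p) :
    prime p -> (5 <= p)%N -> complete_Padovan a -> x != 0 -> y != 0 ->
    (forall n : int, a n = A * x ^ n + B * y ^ n) ->
    (p <= N ^ 2 + 1)%N -> (N <= mult_order (x / y))%N ->
  A = 0 \/ B = 0.
Proof.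
move=> p_pr p5 complete_a x0 y0 a_eq leN le_ord.
have [[a0 _] _ _] := complete_a.
have [->|A0] := eqVneq A 0; first by left.
have [->|B0] := eqVneq B 0; first by right.
have prim := mult_order_primitive (mulf_neq0 x0 (invr_neq0 y0)).
have [||||k ltk] := two_term_power_sum p_pr _ x0 y0 A0 B0 prim.
- by lia.
- by apply: leq_trans leN _; rewrite leq_add2r leq_sqr.
- by move=> n; have := @complete_neq0 _ _ n p_pr p5 complete_a; rewrite a_eq.
(* A common period [t < p.-1] would give [a t = A + B = a 0 = 1], which completeness excludes. *)
- move=> t t0 xt yt; rewrite leqNgt; apply/negP => ltt.
  have := @complete_ne01 _ _ t p_pr p5 complete_a.
  rewrite t0 ltt a_eq -!exprnP xt yt => /(_ isT) /andP[_].
  by have := a_eq 0; rewrite a0 !expr0z => <-; rewrite eqxx.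
case/eqP; rewrite -[RHS](complete_power_sum p_pr p5 complete_a ltk).
by apply: eq_bigr => n _; rewrite a_eq.
Qed.

Lemma complete_geometric_primitive (p : nat) (b : 'F_p) (a : int -> 'F_p) :
    prime p -> (5 <= p)%N -> complete_Padovan a -> (forall n : int, a n = b ^ n) ->
  Padovan_primitive_root b.
Proof.
move=> p_pr p5 complete_a a_eq.
have [[a0 rec] per _] := complete_a.
split; last by have := rec 0; rewrite !add0r !a_eq -!exprnP expr0 expr1 addrC.
have bp : b ^+ p.-1 = 1.
  by have := per 0; rewrite add0r !a_eq -!exprnP subn1.
have p10 : (0 < p.-1)%N by lia.
have [m prim m_dvd] := prim_order_exists p10 bp.
suff -> : (p - 1)%N = m by [].
have m0 := prim_order_gt0 prim; have lem := dvdn_leq p10 m_dvd.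
(* An order [m < p.-1] would make the value 1 recur at index [m], against completeness. *)
have [ltm|] := ltnP m p.-1; last by lia.
have := @complete_ne01 _ _ m p_pr p5 complete_a.
by rewrite m0 ltm a_eq -exprnP (prim_expr_order prim) eqxx andbF => /(_ isT).
Qed.

Lemma primitive_root_complete (p : nat) (b : 'F_p) (a : int -> 'F_p) :
    prime p -> (5 <= p)%N -> Phi_sequence 3 a -> (forall n : int, a n = b ^ n) ->
  Padovan_primitive_root b -> complete_Padovan a.
Proof.
move=> p_pr p5 Phi_a a_eq [prim b3].
have b0 : b != 0 by rewrite (prim_root_eq0 prim); lia.
split=> // [n|].
  by rewrite !a_eq expfzDr // -exprnP (prim_expr_order prim) mulr1.
rewrite Fp_natr_ge2_set //; apply/setP => x; rewrite inE.
apply/imsetP/andP => [[i _ ->]|[x0 x1]].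
  rewrite a_eq -exprnP expf_neq0 // -(prim_order_dvd prim) gtnNdvd //.
  by have := ltn_ord i; lia.
have xp : x ^+ (p - 1) = 1 by rewrite subn1 Fp_expf_pred.
have [[[|i] lti] xi] := prim_rootP prim xp.
  by rewrite xi expr0 eqxx in x1.
have lti' : (i < p - 2)%N by lia.
by exists (Ordinal lti'); rewrite //= a_eq.
Qed.

Theorem theorem1p3 (p : nat) (p_prime : prime p) (p_ge5 : (5 <= p)%N)
    (alpha beta gamma : 'F_p)
    (roots_distinct : uniq [:: alpha; beta; gamma])
    (alpha_root : root ('X^3 - 'X - 1 : {poly 'F_p}) alpha)
    (beta_root : root ('X^3 - 'X - 1 : {poly 'F_p}) beta)
    (gamma_root : root ('X^3 - 'X - 1 : {poly 'F_p}) gamma)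
    (p_le : (p <= min_ratio_order alpha beta gamma ^ 2 + 1)%N)
    (a : int -> 'F_p) (a_Phi : Phi_sequence 3 a) :
  complete_Padovan a <->
  exists b : 'F_p, Padovan_primitive_root b /\ forall n : int, a n = b ^ n.
Proof.
split=> [complete_a | [b [prim a_eq]]]; last exact: primitive_root_complete prim.
have cube (x : 'F_p) : root ('X^3 - 'X - 1) x -> x ^+ 3 = x + 1.
  rewrite /root !hornerE => /eqP e.
  by apply/eqP; rewrite -subr_eq0 opprD addrA e.
have {alpha_root}al3 := cube _ alpha_root; have {beta_root}be3 := cube _ beta_root.
have {gamma_root}ga3 := cube _ gamma_root.
have prod1 := Padovan_root_prod roots_distinct al3 be3 ga3.
have /and3P[al0 be0 ga0] : [&& alpha != 0, beta != 0 & gamma != 0].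
  by rewrite -!negb_or -!mulf_eq0 mulrA prod1 oner_neq0.
have [A [B [C [sum1 a_eq]]]] :=
  Padovan_closed_form al0 be0 ga0 roots_distinct al3 be3 ga3 a_Phi.
have geometric (b : 'F_p) : (forall n : int, a n = b ^ n) ->
    exists b : 'F_p, Padovan_primitive_root b /\ forall n : int, a n = b ^ n.
  by move=> e; exists b; split=> //; apply: complete_geometric_primitive e.
have ABC0 : A * B * C = 0.
  (* [p >= 5] makes 3 an admissible order and, below, makes 6 invertible modulo [p]. *)
  have lt3 : (0 < 3 < p.-1)%N by lia.
  have a_eqn (n : nat) :
    a n = A * alpha ^+ n + B * beta ^+ n + C * gamma ^+ n := a_eq n.
  have := complete_power_sum p_prime p_ge5 complete_a lt3.
  under eq_bigr do rewrite a_eqn.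
  rewrite Padovan_cubic_power_sum // => /eqP.
  rewrite oppr_eq0 -!mulrA mulf_eq0 mulrA => /orP[|/eqP //].
  rewrite -(dvdn_pcharf (pchar_Fp p_prime)) (_ : 6 = 3`!)%N //.
  by rewrite (negPf (prime_ndvd_fact p_prime _)) //; lia.
set M := min_ratio_order alpha beta gamma in p_le.
have [leab lebc leca] : [/\ (M <= mult_order (alpha / beta))%N,
    (M <= mult_order (beta / gamma))%N & (M <= mult_order (gamma / alpha))%N].
  by rewrite /M /min_ratio_order; split; lia.
have two_term := @complete_two_term p _ _ _ _ _ a p_prime p_ge5 complete_a.
move/eqP: ABC0; rewrite !mulf_eq0 => /orP[/orP[]|] /eqP e0;
  rewrite e0 ?add0r ?addr0 in sum1.
- have a_eq' n : a n = B * beta ^ n + C * gamma ^ n.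
    by rewrite a_eq e0 mul0r add0r.
  have [z0|z0] := two_term _ _ _ _ _ be0 ga0 a_eq' p_le lebc;
    rewrite z0 ?add0r ?addr0 in sum1.
    by apply: (geometric gamma) => n; rewrite a_eq' z0 sum1 mul0r mul1r add0r.
  by apply: (geometric beta) => n; rewrite a_eq' z0 sum1 mul0r mul1r addr0.
(* The terms are put in this order to match the ratio [gamma / alpha] in the minimum. *)
- have a_eq' n : a n = C * gamma ^ n + A * alpha ^ n.
    by rewrite a_eq e0 mul0r addr0 addrC.
  have [z0|z0] := two_term _ _ _ _ _ ga0 al0 a_eq' p_le leca;
    rewrite z0 ?add0r ?addr0 in sum1.
    by apply: (geometric alpha) => n; rewrite a_eq' z0 sum1 mul0r mul1r add0r.
  by apply: (geometric gamma) => n; rewrite a_eq' z0 sum1 mul0r mul1r addr0.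
have a_eq' n : a n = A * alpha ^ n + B * beta ^ n.
  by rewrite a_eq e0 mul0r addr0.
have [z0|z0] := two_term _ _ _ _ _ al0 be0 a_eq' p_le leab;
  rewrite z0 ?add0r ?addr0 in sum1.
  by apply: (geometric beta) => n; rewrite a_eq' z0 sum1 mul0r mul1r add0r.
by apply: (geometric alpha) => n; rewrite a_eq' z0 sum1 mul0r mul1r addr0.
Qed.
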